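(* There exists a function $f:\mathbb{N}\to\mathbb{N}$ such that the following holds. Let $P$ be a Poisson algebra over a field $\mathbb{F}$ which is solvable of derived length $n$. Then the Poisson ideal $\mathcal{J}$ of $P$ generated by all elements $\{\{\{x_1,x_2\},\{x_3,x_4\}\},x_5\}$ with $x_1,\ldots,x_5\in P$ is associative nilpotent of index at most $f(n)$; that is, $\mathcal{J}$ is associative nilpotent of index bounded by a function of $n$.
   Context: A Poisson algebra $P$ over a field $\mathbb{F}$ (of arbitrary characteristic) is a commutative associative $\mathbb{F}$-algebra with unity equipped with a Lie bracket $\{\,,\}$ (bilinear over $\mathbb{F}$) satisfying the Leibniz rule $\{a\cdot b,c\}=a\cdot\{b,c\}+b\cdot\{a,c\}$ for all $a,b,c\in P$. A Poisson ideal is a subspace that is an ideal for both the associative multiplication and the Lie bracket. For subspaces $A,B$, $\{A,B\}$ denotes the linear span of all $\{a,b\}$ with $a\in A$, $b\in B$. Set $\delta_0(P)=P$ and $\delta_k(P)=\{\delta_{k-1}(P),\delta_{k-1}(P)\}$ for $k>0$. $P$ is solvable if $\delta_n(P)=0$ for some $n$ (i.e. $P$ is solvable as a Lie algebra), and the minimal such $n$ is its derived length. A Poisson ideal $I$ is associative nilpotent of index at most $k$ if $I^k=0$, i.e. the product of any $k$ elements of $I$ is zero. *)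

(* Defs.v *)
From HB Require Import structures.
From mathcomp Require Import all_boot all_algebra.
From mathcomp Require Import classical_sets.
Set Implicit Arguments.
Unset Strict Implicit.
Unset Printing Implicit Defensive.
Import GRing.Theory.
Local Open Scope classical_set_scope.
Local Open Scope ring_scope.

(* The vector space structure is part of the mixin because [comAlgType F] and
   its ancestor [lalgType F] impose 1 != 0, while the zero algebra is a Poisson
   algebra too (the one of derived length 0), and MathComp has no common
   extension of [comPzRingType] and [lmodType F].  As the product is commutative
   and distributive, [scalAl] suffices for it to be F-bilinear. *)
HB.mixin Record isPoisson (F : fieldType) P of GRing.ComPzRing P := {
  scal : F -> P -> P;
  scalA : forall (a b : F) (x : P), scal a (scal b x) = scal (a * b) x;
  scal1 : forall x : P, scal 1 x = x;
  scalDr : forall (a : F) (x y : P), scal a (x + y) = scal a x + scal a y;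
  scalDl : forall (a b : F) (x : P), scal (a + b) x = scal a x + scal b x;
  scalAl : forall (a : F) (x y : P), scal a (x * y) = scal a x * y;
  bracket : P -> P -> P;
  bracket_linearl : forall (a : F) (x y z : P),
    bracket (scal a x + y) z = scal a (bracket x z) + bracket y z;
  bracket_linearr : forall (a : F) (x y z : P),
    bracket z (scal a x + y) = scal a (bracket z x) + bracket z y;
  (* alternating, not just antisymmetric: the characteristic may be 2 *)
  bracket_alt : forall x : P, bracket x x = 0;
  bracket_jacobi : forall x y z : P,
    bracket x (bracket y z) + bracket y (bracket z x)
      + bracket z (bracket x y) = 0;
  bracket_leibniz : forall x y z : P,
    bracket (x * y) z = x * bracket y z + y * bracket x z
}.

#[short(type="poissonAlgType")]
HB.structure Definition PoissonAlgebra (F : fieldType) :=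
  { P of GRing.ComPzRing P & isPoisson F P }.

Section PoissonDefs.
Variables (F : fieldType) (P : poissonAlgType F).
Implicit Types (A B I : set P) (n k : nat).

Definition is_subspace A : Prop :=
  A 0 /\ forall (a : F) (x y : P), A x -> A y -> A (scal a x + y).

Definition linear_span A : set P := smallest is_subspace A.

Definition bracket_span A B : set P :=
  linear_span [set bracket a b | a in A & b in B].

Fixpoint delta n : set P :=
  if n is m.+1 then bracket_span (delta m) (delta m) else setT.

Definition has_derived_length n : Prop :=
  delta n = [set 0] /\ forall m : nat, (m < n)%N -> delta m <> [set 0].

(* By commutativity and antisymmetry, one-sided closure is enough. *)
Definition is_poisson_ideal I : Prop :=
  [/\ is_subspace I,
      forall x y : P, I y -> I (x * y) &
      forall x y : P, I y -> I (bracket x y)].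

Definition poisson_ideal_gen A : set P := smallest is_poisson_ideal A.

(* For k = 0 the product is 1, so that the condition says 1 = 0 in P. *)
Definition assoc_nilpotent I k : Prop :=
  forall x : 'I_k -> P, (forall i, I (x i)) -> \prod_(i < k) x i = 0.

Definition center_by_metabelian_values : set P :=
  [set z | exists x1 x2 x3 x4 x5 : P,
     z = bracket (bracket (bracket x1 x2) (bracket x3 x4)) x5].

End PoissonDefs.

Arguments center_by_metabelian_values {F} P _.

(* Main.v *)
Require Import Defs.
From mathcomp Require Import all_boot all_algebra.
From mathcomp Require Import classical_sets ring.

Set Implicit Arguments.
Unset Strict Implicit.
Unset Printing Implicit Defensive.
Import GRing.Theory.
Local Open Scope classical_set_scope.
Local Open Scope ring_scope.

(** The Poisson bracket {x,y} is written x # y in formulas.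

    The proof descends along the derived series.  For k >= 2 put A = delta_k,
    L = delta_(k-1), so that A = {L,L}; it is enough to bound the exponent m
    for which {A,P}^m lies in the Poisson ideal generated by {delta_(k+1),P},
    that is, to bound m when {A,A} is central: such exponents multiply along
    the series.  A Lie ideal U absorbs brackets
    of the whole ideal P{U,U} ([lie_ideal_absorb]).  Hence a central z in
    {A,A} has z{x,y} in A, two such elements multiply delta_2 into {A,A}, and
    z z' {A,P} = 0 ([central_mul_derived]); this reduces to the case of an
    abelian A.

    When A is abelian, expanding {b,{a,xy}} = 0 shows that {a,x}{b,y} changes
    sign when x and y are exchanged, hence also when a and b are
    ([abelian_skew]).  Products of many elements of {A,P} therefore behave
    like exterior products, in every characteristic, and the task is to find
    enough incompatible symmetries.  As {A,P} may be used as a supply of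
    multipliers, whatever is killed by a bounded power of it may be discarded.

    A first collision of signs shows that {A,L} is central up to such
    multipliers ([derived_bracket_near_central]).  Then, on L1 = {L,P}, the
    triple brackets T(p,n,r) = {{p,n},r} are alternating up to multipliers
    from {A,P} ([derived_triple_skew]).  The Jacobi identity gives 3T = 0,
    and the sign of the permutation which exchanges two triples gives
    2TT' = 0; so TT' = 0 whatever the characteristic ([triple_pow]).

    It remains to climb back from A1 = {L1,L1} to A.  If V is an abelian Lie
    ideal and t, t' are such that {t,P} and {t',P} centralize V, then
    {t,t'}{V,P}{V,P} = 0 ([second_centralizer_bracket]).  Modulo {A1,L1} this
    applies to L1 and V = A1 and shows that {A1,P} is nilpotent; modulo
    {A1,P}, central multiplication by A1 reduces to A1 = 0, where it applies
    to L and V = L1 and shows that {A,P} is nilpotent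
    ([pow_sub_metabelian]). *)

Local Notation "x # y" := (bracket x y) (at level 39, left associativity).

(** * Bracket calculus, subspaces and Lie ideals *)

Section PoissonTheory.
Variables (F : fieldType) (P : poissonAlgType F).
Implicit Types (x y z t u v w : P) (U V W I K : set P).

Lemma bracketDl x y z : (x + y) # z = x # z + y # z.
Proof. by rewrite -[x]scal1 bracket_linearl !scal1. Qed.

Lemma bracketDr x y z : z # (x + y) = z # x + z # y.
Proof. by rewrite -[x]scal1 bracket_linearr !scal1. Qed.

Lemma bracket0l x : 0 # x = 0.
Proof. by apply: (addrI (0 # x)); rewrite -bracketDl !addr0. Qed.

Lemma bracket0r x : x # 0 = 0.
Proof. by apply: (addrI (x # 0)); rewrite -bracketDr !addr0. Qed.

Lemma bracketNl x y : (- x) # y = - (x # y).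
Proof. by apply: (addrI (x # y)); rewrite -bracketDl !subrr bracket0l. Qed.

Lemma bracketNr x y : y # (- x) = - (y # x).
Proof. by apply: (addrI (y # x)); rewrite -bracketDr !subrr bracket0r. Qed.

Lemma bracketC x y : x # y = - (y # x).
Proof.
have := bracket_alt (x + y).
rewrite bracketDl !bracketDr !bracket_alt add0r addr0 => h.
by apply/eqP; rewrite -subr_eq0 opprK h.
Qed.

Lemma bracketMl x y z : (x * y) # z = x * (y # z) + y * (x # z).
Proof. exact: bracket_leibniz. Qed.

Lemma bracketMr x y z : x # (y * z) = y * (x # z) + z * (x # y).
Proof.
by rewrite bracketC bracketMl opprD -!mulrN -!(bracketC x).
Qed.

Lemma scalE (a : F) x : scal a x = scal a 1 * x.
Proof. by rewrite -scalAl mul1r. Qed.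

Lemma scal0 (a : F) : scal a (0 : P) = 0.
Proof. by rewrite scalE mulr0. Qed.

Definition bracketE := (bracketDl, bracketDr, bracketNl, bracketNr,
  bracketMl, bracketMr, bracket0l, bracket0r).

Lemma bracketA x y z : x # (y # z) = x # y # z - x # z # y.
Proof.
have := bracket_jacobi x y z.
rewrite [y # (z # x)]bracketC [z # (x # y)]bracketC [z # x]bracketC bracketNl.
rewrite opprK => h.
by apply/eqP; rewrite -subr_eq0 -[X in _ == X]h; apply/eqP; ring.
Qed.

Lemma bracketAC x y z : x # y # z = x # z # y + x # (y # z).
Proof. by rewrite bracketA; ring. Qed.

(** Unlike the Leibniz rule, this consequence of it has no coefficient outside
    a bracket; so it shows that elements which bracket the whole algebra into
    a fixed subspace are closed under products. *)
Lemma bracketM_cyclic x y z : (x * y) # z = - ((y * z) # x) - ((z * x) # y).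
Proof.
by rewrite !bracketE (bracketC z x) (bracketC z y) (bracketC y x); ring.
Qed.

Lemma subspaceD U x y : is_subspace U -> U x -> U y -> U (x + y).
Proof. by move=> [_ hU] Ux Uy; rewrite -[x]scal1; apply: hU. Qed.

Lemma subspaceZ U (a : F) x : is_subspace U -> U x -> U (scal a x).
Proof. by move=> [U0 hU] Ux; rewrite -[scal a x]addr0; apply: hU. Qed.

Lemma subspaceN U x : is_subspace U -> U x -> U (- x).
Proof.
move=> sU Ux; have -> : - x = scal (-1) x; last exact: subspaceZ.
apply: (addrI x); rewrite subrr -[X in X + _]scal1 -scalDl subrr.
by apply: (addrI (scal 0 x)); rewrite -scalDl !addr0.
Qed.

Lemma subspaceB U x y : is_subspace U -> U x -> U y -> U (x - y).
Proof. by move=> sU Ux Uy; apply: subspaceD => //; apply: subspaceN. Qed.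

Lemma subspace_preim (f : P -> P) U : is_subspace U ->
  (forall (a : F) x y, f (scal a x + y) = scal a (f x) + f y) ->
  is_subspace [set x | U (f x)].
Proof.
move=> sU fL; split=> [|a x y Ux Uy] /=.
  have := fL 0 0 0; rewrite scal0 addr0 -{1}[f 0]scal1 => h.
  have -> : f 0 = 0; last exact: sU.1.
  have z0 : forall x, scal 0 x = 0 :> P.
    by move=> x; apply: (addrI (scal 0 x)); rewrite -scalDl !addr0.
  have := fL (-1) 0 0; rewrite scal0 addr0.
  by rewrite -{3}[f 0]scal1 -scalDl addNr z0.
by rewrite fL; apply: sU.2.
Qed.

Lemma linear_span_subspace U : is_subspace (linear_span U).
Proof.
split=> [V [sV _]|a x y hx hy V [sV UV]]; first exact: sV.1.
by apply: sV.2; [apply: hx | apply: hy].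
Qed.

Lemma linear_span_min U V : is_subspace V -> U `<=` V -> linear_span U `<=` V.
Proof. by move=> sV UV; apply: smallest_sub. Qed.

Lemma bracket_span_subspace U V : is_subspace (bracket_span U V).
Proof. exact: linear_span_subspace. Qed.

Lemma bracket_spanI U V x y : U x -> V y -> bracket_span U V (x # y).
Proof. by move=> Ux Vy; apply: sub_gen_smallest; exists x => //; exists y. Qed.

Lemma bracket_span_min U V W : is_subspace W ->
  (forall x y, U x -> V y -> W (x # y)) -> bracket_span U V `<=` W.
Proof.
move=> sW h; apply: linear_span_min => // _ [x Ux [y Vy <-]]; exact: h.
Qed.

Definition lie_ideal U := is_subspace U /\ forall x y, U x -> U (x # y).

Lemma lie_idealr U x y : lie_ideal U -> U x -> U (y # x).
Proof.
by move=> [sU hU] Ux; rewrite bracketC; apply: subspaceN => //; apply: hU.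
Qed.

Lemma lie_ideal_setT : lie_ideal setT.
Proof. by split. Qed.

Lemma bracket_span_lie_ideal U V :
  lie_ideal U -> lie_ideal V -> lie_ideal (bracket_span U V).
Proof.
move=> iU iV; have sUV := bracket_span_subspace U V; split=> // w y.
suff h : bracket_span U V `<=` [set x | bracket_span U V (x # y)] by apply: h.
apply: bracket_span_min => [|x z Ux Vz] /=.
  apply: (@subspace_preim (fun x => x # y) (bracket_span U V) sUV) => a x z.
  by rewrite bracket_linearl.
rewrite bracketAC; apply: (subspaceD sUV); apply: bracket_spanI => //.
  exact: iU.2.
exact: iV.2.
Qed.

Lemma bracket_span_subl U V : lie_ideal U -> bracket_span U V `<=` U.
Proof.
by move=> iU; apply: (bracket_span_min iU.1) => x y Ux _; apply: iU.2.
Qed.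

Lemma bracket_spanS U U' V V' :
  U `<=` U' -> V `<=` V' -> bracket_span U V `<=` bracket_span U' V'.
Proof.
move=> UU' VV'; apply: bracket_span_min; first exact: bracket_span_subspace.
by move=> x y /UU' Ux /VV' Vy; apply: bracket_spanI.
Qed.

(** A Lie ideal [U] bracket-absorbs the whole associative ideal generated by
    [bracket_span U U]: for u, v in [U] one has p{u,v} = {u,pv} - v{u,p}, and
    [bracketM_cyclic] handles the product of the two elements v and {u,p}
    of [U]. *)
Lemma lie_ideal_absorb U p w y :
  lie_ideal U -> bracket_span U U w -> U ((p * w) # y).
Proof.
move=> iU; suff h : bracket_span U U `<=` [set w | U ((p * w) # y)] by apply: h.
apply: bracket_span_min => [|u v Uu Uv] /=.
  apply: (@subspace_preim (fun w => (p * w) # y) U iU.1).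
  move=> a v z; rewrite mulrDr -bracket_linearl; congr (_ # _).
  by rewrite [p * scal _ _]mulrC -scalAl [v * p]mulrC.
have -> : p * (u # v) = u # (p * v) - v * (u # p) by rewrite bracketMr; ring.
rewrite bracketDl bracketNl bracketM_cyclic.
have [sU hU] := iU; apply: subspaceB => //; first exact/hU/hU.
by apply: subspaceB => //; first apply: subspaceN => //;
  apply: lie_idealr => //; apply: hU.
Qed.

(** * Poisson ideals *)

Lemma ideal_subspace I : is_poisson_ideal I -> is_subspace I.
Proof. by case. Qed.

Lemma poisson_idealMl I x y : is_poisson_ideal I -> I y -> I (x * y).
Proof. by case=> _ h _; apply: h. Qed.

Lemma poisson_idealMr I x y : is_poisson_ideal I -> I y -> I (y * x).
Proof. by rewrite mulrC; apply: poisson_idealMl. Qed.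

Lemma ideal_lie_ideal I : is_poisson_ideal I -> lie_ideal I.
Proof.
move=> [sI _ h]; split=> // x y Ix.
by rewrite bracketC; apply: subspaceN => //; apply: h.
Qed.

Lemma ideal_bracketl I x y : is_poisson_ideal I -> I x -> I (x # y).
Proof. by move=> /ideal_lie_ideal[_ h]; apply: h. Qed.

Lemma ideal_bracketr I x y : is_poisson_ideal I -> I x -> I (y # x).
Proof. by case=> _ _; apply. Qed.

Lemma ideal_eq0 I x : is_poisson_ideal I -> x = 0 -> I x.
Proof. by move=> [[I0 _] _ _] ->. Qed.

(** Membership is proved by subtracting multiples of known members until an
    identity of the algebra remains. *)
Lemma ideal_reduce I p r x : is_poisson_ideal I -> I r -> I (x - p * r) -> I x.
Proof.
move=> iI Ir h; rewrite -[x](subrK (p * r)).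
by apply: subspaceD; [apply: ideal_subspace | | apply: poisson_idealMl].
Qed.

Lemma poisson_ideal_gen_ideal U : is_poisson_ideal (poisson_ideal_gen U).
Proof.
split=> [|x y hy V [iV UV]|x y hy V [iV UV]].
- split=> [V [iV _]|a x y hx hy V [iV UV]]; first exact: (ideal_subspace iV).1.
  by apply: (ideal_subspace iV).2; [apply: hx | apply: hy].
- by apply: poisson_idealMl => //; apply: hy.
- by apply: ideal_bracketr => //; apply: hy.
Qed.

Lemma poisson_ideal_gen_min U I :
  is_poisson_ideal I -> U `<=` I -> poisson_ideal_gen U `<=` I.
Proof. by move=> iI UI; apply: smallest_sub. Qed.

Lemma sub_poisson_ideal_gen U : U `<=` poisson_ideal_gen U.
Proof. exact: sub_gen_smallest. Qed.

Lemma zero_ideal : is_poisson_ideal ([set 0] : set P).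
Proof.
split=> [|x y /= ->|x y /= ->].
- by split=> [//|a x y /= -> ->]; rewrite scal0 addr0.
- by rewrite mulr0.
- by rewrite bracket0r.
Qed.

(** * Powers of a subset modulo an ideal *)

(** The ideal quotient (I : G^k).  As an iterated quotient it makes exponents
    add definitionally, and it is again a Poisson ideal, so that everything
    proved modulo an ideal can be reapplied modulo its quotients. *)
Fixpoint colon_pow (G : set P) (k : nat) (I : set P) : set P :=
  if k is k'.+1 then [set x | forall g, G g -> colon_pow G k' I (x * g)]
  else I.

Definition pow_sub G k I := colon_pow G k I 1.

Definition bracket_stable (G : set P) := forall x y, G x -> G (x # y).

Lemma colon_pow_ideal G k I : bracket_stable G -> is_poisson_ideal I ->
  is_poisson_ideal (colon_pow G k I).
Proof.
move=> sG iI; elim: k => [|k iK] //=.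
split=> [|x y hy g Gg|x y hy g Gg].
- split=> [g _|a x y hx hy g Gg]; first by rewrite mul0r; apply: (ideal_eq0 iK).
  by rewrite mulrDl -scalAl; apply: (ideal_subspace iK).2; [apply: hx|apply: hy].
- by rewrite -mulrA; apply: (poisson_idealMl _ iK); apply: hy.
- have -> : x # y * g = x # (y * g) - y * (x # g) by rewrite bracketMr; ring.
  apply: subspaceB; first exact: ideal_subspace.
    by apply: (ideal_bracketr _ iK); apply: hy.
  rewrite bracketC mulrN; apply: subspaceN; first exact: ideal_subspace.
  by apply: hy; apply: sG.
Qed.

Lemma colon_powD G a b I :
  colon_pow G (a + b) I = colon_pow G a (colon_pow G b I).
Proof. by elim: a => [|a IH] //=; rewrite IH. Qed.

Lemma colon_pow_anti G H k I : G `<=` H -> colon_pow H k I `<=` colon_pow G k I.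
Proof.
by move=> GH; elim: k => [|k IH] //= x hx g Gg; apply: IH; apply: hx; apply: GH.
Qed.

Lemma sub_colon_pow G k I : is_poisson_ideal I -> I `<=` colon_pow G k I.
Proof.
by move=> iI; elim: k => [|k IH] //= x Ix g Gg; apply: IH; apply: poisson_idealMr.
Qed.

Lemma colon_powM G k I K x y : (forall i, I i -> K (x * i)) ->
  colon_pow G k I y -> colon_pow G k K (x * y).
Proof.
move=> h; elim: k y => [|k IH] y //=; first exact: h.
by move=> hy g Gg; rewrite -mulrA; apply: IH; apply: hy.
Qed.

Lemma pow_sub_trans G a b I K :
  pow_sub G a K -> pow_sub K b I -> pow_sub G (b * a) I.
Proof.
rewrite /pow_sub => hG; elim: b 1 => [|b IH] x //=.
rewrite mulSn colon_powD => h.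
by rewrite -[x]mulr1; apply: colon_powM hG => i Ki; apply: IH; apply: h.
Qed.

(** Bracket-stability of [G] makes the quotients by powers of [G] Poisson
    ideals, so the factors of a product can be traded one at a time for
    elements of the generated Poisson ideal. *)
Lemma colon_pow_gen G k I : bracket_stable G -> is_poisson_ideal I ->
  colon_pow G k I `<=` colon_pow (poisson_ideal_gen G) k I.
Proof.
move=> sG iI; elim: k => [|k IH] //= x hx j Jj; apply: IH.
have iK := colon_pow_ideal k sG iI.
have iX : is_poisson_ideal (colon_pow G k.+1 I) by apply: colon_pow_ideal.
(* Quantifying over all such multipliers makes the set of admissible right
   factors closed under brackets. *)
pose J := [set i | forall y, colon_pow G k.+1 I y -> colon_pow G k I (y * i)].
suff: J j by apply.
suff h : poisson_ideal_gen G `<=` J by apply: h.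
apply: poisson_ideal_gen_min => [|g Gg y hy]; last exact: hy.
split=> [|z i Ji y hy|z i Ji y hy].
- split=> [y _|a i i' Ji Ji' y hy]; first by rewrite mulr0; apply: (ideal_eq0 iK).
  rewrite mulrDr [y * scal _ _]mulrC -scalAl [i * y]mulrC.
  by apply: (ideal_subspace iK).2; [apply: Ji|apply: Ji'].
- by rewrite mulrCA; apply: poisson_idealMl => //; apply: Ji.
- have -> : y * (z # i) = z # (y * i) - (z # y) * i by rewrite bracketMr; ring.
  apply: subspaceB; first exact: ideal_subspace.
    by apply: ideal_bracketr => //; apply: Ji.
  by apply: Ji; apply: (ideal_bracketr _ iX).
Qed.

Lemma colon_pow_span G k I : is_poisson_ideal I ->
  colon_pow G k I `<=` colon_pow (linear_span G) k I.
Proof.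
move=> iI; have subK m (H : set P) : is_subspace (colon_pow H m I).
  elim: m => [|m IH] /=; first exact: ideal_subspace.
  split=> [g _|a x y hx hy g Gg]; first by rewrite mul0r; apply: IH.1.
  by rewrite mulrDl -scalAl; apply: IH.2; [apply: hx|apply: hy].
elim: k => [|k IH] //= x hx; apply: linear_span_min => [|g Gg]; last first.
  by apply: IH; apply: hx.
apply: (@subspace_preim (fun g => x * g) (colon_pow (linear_span G) k I)) => //.
move=> a g g'.
by rewrite mulrDr [x * scal _ _]mulrC -scalAl [g * x]mulrC.
Qed.

Lemma colon_pow_setU G W k I : is_poisson_ideal I ->
  W `<=` I -> colon_pow G k I `<=` colon_pow (W `|` G) k I.
Proof.
move=> iI WI; elim: k => [|k IH] //= x hx g [Wg|Gg]; apply: IH; last exact: hx.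
by apply: (sub_colon_pow _ _ iI); apply: poisson_idealMl => //; apply: WI.
Qed.

Definition ideal_add I W := poisson_ideal_gen (I `|` W).

Lemma ideal_add_ideal I W : is_poisson_ideal (ideal_add I W).
Proof. exact: poisson_ideal_gen_ideal. Qed.

Lemma sub_ideal_addl I W : I `<=` ideal_add I W.
Proof. by move=> x Ix; apply: sub_poisson_ideal_gen; left. Qed.

Lemma sub_ideal_addr I W : W `<=` ideal_add I W.
Proof. by move=> x Wx; apply: sub_poisson_ideal_gen; right. Qed.

Lemma pow_sub_ideal_add I W k K : is_poisson_ideal I -> is_poisson_ideal K ->
  I `<=` K -> bracket_stable W -> pow_sub W k K -> pow_sub (ideal_add I W) k K.
Proof.
move=> iI iK IK sW /(colon_pow_setU iK IK) h; apply: colon_pow_gen h => //.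
move=> x y [Ix|Wx]; [left|right]; [exact: ideal_bracketl|exact: sW].
Qed.

(** Two products of [k] factors each lie in I + PW, and one more factor
    from [G] kills the product of their components in PW. *)
Lemma pow_sub_square I W G k : is_poisson_ideal I -> bracket_stable W ->
  bracket_stable G -> pow_sub G k (ideal_add I W) ->
  (forall w w' g, W w -> W w' -> G g -> I (w * w' * g)) ->
  pow_sub G (2 * k).+1 I.
Proof.
move=> iI sW sG hG h.
have iK := colon_pow_ideal 1 sG iI.
rewrite /pow_sub -addn1 colon_powD.
apply: (pow_sub_trans hG); apply: pow_sub_ideal_add => //.
  exact: (sub_colon_pow G 1).
by move=> w Ww w' Ww' g Gg; rewrite mul1r; apply: h.
Qed.

End PoissonTheory.

(** * Lie ideals modulo a Poisson ideal *)

Section LieIdeals.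
Variables (F : fieldType) (P : poissonAlgType F) (I : set P).
Hypothesis iI : is_poisson_ideal I.
Implicit Types (x y z t u v w : P) (U A : set P).

Let sI : is_subspace I := ideal_subspace iI.

(** By [lie_ideal_absorb] a central element z of {U,U} multiplies every
    bracket into U, so z z' {y,l} is congruent to an element of {U,U}, which
    is central. *)
Lemma central_mul_derived U z z' y l w : lie_ideal U ->
  (forall v x, bracket_span U U v -> I (v # x)) ->
  bracket_span U U z -> bracket_span U U z' ->
  bracket_span setT setT y -> bracket_span setT setT l ->
  I (z * z' * (y # l # w)).
Proof.
move=> iU cU Uz Uz'.
pose near v y := exists2 s, U s & I (v * y - s).
have nearP v : bracket_span U U v ->
    forall y, bracket_span setT setT y -> near v y.
  move=> Uv; suff h : bracket_span setT setT `<=` near v by [].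
  apply: bracket_span_min => [|x x' _ _].
    split=> [|a x x' [s Us hs] [s' Us' hs']].
      by exists 0; [exact: iU.1.1 | apply: ideal_eq0; rewrite // mulr0 subr0].
    exists (scal a s + s'); first exact: iU.1.2.
    have -> : v * (scal a x + x') - (scal a s + s')
            = scal a (v * x - s) + (v * x' - s').
      by rewrite (scalE a x) (scalE a s) (scalE a (v * x - s)); ring.
    exact: sI.2.
  exists ((x * v) # x'); first exact: lie_ideal_absorb.
  apply: (ideal_reduce (p := - x) iI (cU v x' Uv)); apply: (ideal_eq0 iI).
  by rewrite bracketMl; ring.
move=> hy hl.
have [s Us hs] := nearP z Uz y hy; have [s' Us' hs'] := nearP z' Uz' l hl.
have hss : I (s # s' # w) by apply: cU; apply: bracket_spanI.
have zc x : I (z # x) by apply: cU.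
have z'c x : I (z' # x) by apply: cU.
have e1 : I ((z * y - s) # (z' * l) # w) by do 2!apply: (ideal_bracketl _ iI).
have e2 : I (s # (z' * l - s') # w).
  by apply: ideal_bracketl => //; apply: ideal_bracketr.
have e3 : I ((z * y) # (z' * l) # w).
  apply: (ideal_reduce (p := 1) iI e1); apply: (ideal_reduce (p := 1) iI e2).
  apply: (ideal_reduce (p := 1) iI hss); apply: (ideal_eq0 iI).
  by rewrite !(bracketDl, bracketNl, bracketDr, bracketNr); ring.
have h1 : I ((z # (z' * l) * y) # w).
  by apply: ideal_bracketl => //; apply: (poisson_idealMr _ iI).
have h2 : I ((z * (y # z' * l)) # w).
  apply: ideal_bracketl => //.
  apply: (poisson_idealMl _ iI); apply: (poisson_idealMr _ iI).
  by rewrite bracketC; apply: subspaceN.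
apply: (ideal_reduce (p := 1) iI e3); apply: (ideal_reduce (p := -1) iI h1).
apply: (ideal_reduce (p := -1) iI h2).
apply: (ideal_reduce (p := - (z' * (y # l))) iI (zc w)).
apply: (ideal_reduce (p := - (z * (y # l))) iI (z'c w)); apply: (ideal_eq0 iI).
by rewrite !bracketE; ring.
Qed.

Section Abelian.
Variable A : set P.
Hypothesis iA : lie_ideal A.
Hypothesis abA : forall a b, A a -> A b -> I (a # b).

(** The cross terms of the Leibniz expansion of {b,{a,xy}}. *)
Lemma abelian_skew a b x y : A a -> A b ->
  I ((a # x) * (b # y) + (a # y) * (b # x)).
Proof.
move=> Aa Ab.
apply: (ideal_reduce (p := 1) iI (abA Ab (iA.2 a (x * y) Aa))).
apply: (ideal_reduce (p := - x) iI (abA Ab (iA.2 a y Aa))).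
apply: (ideal_reduce (p := - y) iI (abA Ab (iA.2 a x Aa))).
by apply: (ideal_eq0 iI); rewrite !bracketE; ring.
Qed.

(** The elements t with {t,P} inside the centralizer of A form an associative
    subalgebra, by [bracketM_cyclic]; as in [lie_ideal_absorb] it contains
    q{t,t'} for every q.  The conclusion is the cross term of the statement
    that {{pu,xb},a} = 0 for u = {t,t'}. *)
Lemma second_centralizer_bracket t t' p b x a :
  (forall x a, A a -> I (t # x # a)) -> (forall x a, A a -> I (t' # x # a)) ->
  A a -> A b -> I ((t # t') * (p # b) * (x # a)).
Proof.
move=> ht ht' Aa Ab; pose u := t # t'.
(* The centralizer of A is a Lie ideal. *)
have cent s : (forall a, A a -> I (s # a)) -> forall x a, A a -> I (s # x # a).
  move=> hs {}x {}a {}Aa; rewrite bracketAC; apply: subspaceD => //.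
    by apply: ideal_bracketl => //; apply: hs.
  by apply: hs; apply: lie_idealr.
have hu q z c : A c -> I (((q * u) # z) # c).
  move=> Ac; have -> : q * u = t # (q * t') - t' * (t # q).
    by rewrite /u bracketMr; ring.
  rewrite bracketDl bracketNl bracketM_cyclic !(bracketDl, bracketNl).
  apply: subspaceB => //.
    by apply: (cent (t # (q * t'))) => // d; apply: ht.
  apply: subspaceB => //.
    apply: subspaceN => //; rewrite (bracketC _ t') bracketNl.
    by apply: subspaceN => //; apply: ht'.
  rewrite (bracketC (z * t')) bracketNl; apply: subspaceN => //.
  by apply: (cent (t # q)) => // d; apply: ht.
have hub : I (u # b) by apply: ht.
apply: (ideal_reduce (p := 1) iI (hu p (x * b) a Aa)).
apply: (ideal_reduce (p := - x) iI (hu p b a Aa)).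
apply: (ideal_reduce (p := - b) iI (hu p x a Aa)).
apply: (ideal_reduce (p := - ((p * u) # x)) iI (abA Ab Aa)).
apply: (ideal_reduce (p := - (x # a) * p) iI hub).
by apply: (ideal_eq0 iI); rewrite -/u !bracketE; ring.
Qed.
End Abelian.
End LieIdeals.

(** * Lie ideals whose derived ideal is abelian *)

Section Metabelian.
Variables (F : fieldType) (P : poissonAlgType F) (I : set P).
Hypothesis iI : is_poisson_ideal I.
Variable L : set P.
Hypothesis iL : lie_ideal L.
Let A := bracket_span L L.
Hypothesis abA : forall a b, A a -> A b -> I (a # b).
Implicit Types (a b c d e f g l x y z t u v w : P).

Let sI : is_subspace I := ideal_subspace iI.
Let iA : lie_ideal A := bracket_span_lie_ideal iL iL.
Let Ax a x : A a -> A (a # x) := @proj2 _ _ iA a x.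
Let skew := abelian_skew iI iA abA.

Local Notation reduce p h := (ideal_reduce (p := p) iI h).
Local Notation ring0 := (ideal_eq0 iI).

(** [abelian_skew] exchanges z with l on the left and z with y on the right;
    the results differ by a multiple of {c,{y,l}}, and {y,l} is in A. *)
Lemma derived_swap c d y l z : A c -> A d -> L y -> L l ->
  I ((c # y # z) * (d # l) - (c # l # z) * (d # y)).
Proof.
move=> Ac Ad Ly Ll.
apply: (reduce 1 (skew z l (Ax y Ac) Ad)).
apply: (reduce (-1) (skew z y (Ax l Ac) Ad)).
apply: (reduce (- (d # z)) (abA Ac (bracket_spanI Ly Ll))).
by apply: ring0; rewrite bracketA; ring.
Qed.

(** The polarised second derivative terms that appear in [derived_swap] when
    y is specialised to a bracket with a coefficient in A.  The expression is
    symmetric in c, e; modulo I it is skew in y, x, z. *)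
Definition sym_second c e y x z :=
  (c # y # x) * (e # z) + (e # y # x) * (c # z).

Let absorb f x y : A f -> L ((f * x) # y).
Proof. by move=> Af; rewrite mulrC; apply: lie_ideal_absorb. Qed.

(** For f in A the element {fx,y} belongs to L although {x,y} may not.  The
    defects measure how far bracketing {efx,y} is from e times bracketing
    {fx,y}: a comparison of [derived_swap] at these two elements of L then
    leaves only terms with the common factor f. *)
Let first_defect d e f x y : A d -> A e -> A f ->
  I (d # ((e * (f * x)) # y) - e * (d # ((f * x) # y)) - f * (d # x) * (e # y)).
Proof.
move=> Ad Ae Af.
apply: (reduce ((f * x) # y) (abA Ad Ae)).
apply: (reduce (x * (e # y)) (abA Ad Af)).
apply: (reduce (f * x) (abA Ad (Ax y Ae))).
apply: ring0; rewrite (bracketMl e (f * x)); set Y := (f * x) # y.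
by rewrite (bracketDr _ _ d) !(bracketMr d); ring.
Qed.

Let second_defect c e f x y z : A c -> A e -> A f ->
  I (c # ((e * (f * x)) # y) # z - e * (c # ((f * x) # y) # z)
     + f * sym_second c e y x z).
Proof.
move=> Ac Ae Af.
apply: (reduce 1 (ideal_bracketl z iI (first_defect x y Ac Ae Af))).
apply: (reduce ((e # z) * (x # y)) (abA Ac Af)).
apply: (reduce ((e # z) * x) (abA Ac (Ax y Af))).
apply: (reduce (c # x) (skew z y Ae Af)).
apply: (reduce f (skew y z (Ax x Ac) Ae)).
apply: (reduce f (skew z x (Ax y Ae) Ac)).
apply: ring0; rewrite /sym_second.
rewrite [((_ - _) - _) # z]bracketDl bracketDl !bracketNl !(bracketMl _ _ z).
set Y := (e * _) # y.
rewrite (bracketMl f x y) !(bracketDr _ _ c) !(bracketMr c) (bracketA c x y).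
ring.
Qed.

(** [derived_swap] at y := {efx,y} minus e times the same at y := {fx,y}. *)
Let sym_second_transfer f c d e x y z l : A f -> A c -> A d -> A e -> L l ->
  I (f * (sym_second c e y x z * (d # l) + (c # l # z) * (d # x) * (e # y))).
Proof.
move=> Af Ac Ad Ae Ll.
have h1 := derived_swap z Ac Ad (absorb (e * x) y Af) Ll.
have h2 := derived_swap z Ac Ad (absorb x y Af) Ll.
rewrite mulrCA in h1.
apply: (reduce (-1) h1); apply: (reduce e h2).
apply: (reduce (d # l) (second_defect x y z Ac Ae Af)).
apply: (reduce (- (c # l # z)) (first_defect x y Ad Ae Af)).
by apply: ring0; ring.
Qed.

(** [sym_second_transfer] at l := {gf'u,v} minus g times the same at
    l := {f'u,v}. *)
Let sym_second_exchange f f' c d e g x y z u v :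
  A f -> A f' -> A c -> A d -> A e -> A g ->
  I (f * f' * (sym_second c e y x z * (d # u) * (g # v)
               - sym_second c g v u z * (d # x) * (e # y))).
Proof.
move=> Af Af' Ac Ad Ae Ag.
have h1 := sym_second_transfer x y z Af Ac Ad Ae (absorb (g * u) v Af').
have h2 := sym_second_transfer x y z Af Ac Ad Ae (absorb u v Af').
rewrite mulrCA in h1.
apply: (reduce 1 h1); apply: (reduce (- g) h2).
apply: (reduce (- f * sym_second c e y x z) (first_defect u v Ad Ag Af')).
apply: (reduce (- f * (d # x) * (e # y)) (second_defect u v z Ac Ag Af')).
by apply: ring0; ring.
Qed.

Let sym_second_skewl c e x y z : A c -> A e ->
  I (sym_second c e y x z + sym_second c e z x y).
Proof.
move=> Ac Ae; apply: (reduce 1 (ideal_bracketl x iI (skew y z Ac Ae))).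
by apply: ring0; rewrite /sym_second bracketDl !bracketMl; ring.
Qed.

Let sym_second_skewr c e x y z : A c -> A e ->
  I (sym_second c e y x z + sym_second c e y z x).
Proof.
move=> Ac Ae; apply: (reduce 1 (skew x z (Ax y Ac) Ae)).
apply: (reduce 1 (skew x z (Ax y Ae) Ac)).
by apply: ring0; rewrite /sym_second; ring.
Qed.

Let sym_second_out c e d y x z u : A c -> A e -> A d ->
  I (sym_second c e y x z * (d # u) + sym_second c e y x u * (d # z)).
Proof.
move=> Ac Ae Ad; apply: (reduce (c # y # x) (skew z u Ae Ad)).
apply: (reduce (e # y # x) (skew z u Ac Ad)).
by apply: ring0; rewrite /sym_second; ring.
Qed.

(** In S {d,u}{e,v}, with S a value of [sym_second], all the arguments other
    than the labels c, d, e, g may be permuted at the cost of the sign;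
    (y v)(x u) is even. *)
Let sym_second_permute c d e g x y z u v : A c -> A d -> A e -> A g ->
  I (sym_second c g v u z * (d # x) * (e # y)
     - sym_second c g y x z * (d # u) * (e # v)).
Proof.
move=> Ac Ad Ae Ag.
apply: (reduce ((d # x) * (e # y)) (sym_second_skewr u v z Ac Ag)).
apply: (reduce (- (e # y)) (sym_second_out v z u x Ac Ag Ad)).
apply: (reduce ((d # u) * (e # y)) (sym_second_skewr z v x Ac Ag)).
apply: (reduce (- ((d # u) * (e # y))) (sym_second_skewl x v z Ac Ag)).
apply: (reduce (d # u) (sym_second_out z x v y Ac Ag Ae)).
apply: (reduce (- ((d # u) * (e # v))) (sym_second_skewl x z y Ac Ag)).
by apply: ring0; ring.
Qed.

Let sym_second_relabel f f' c d e g x y z u v :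
  A f -> A f' -> A c -> A d -> A e -> A g ->
  I (f * f' * (sym_second c e y x z * (d # u) * (g # v)
               - sym_second c g y x z * (d # u) * (e # v))).
Proof.
move=> Af Af' Ac Ad Ae Ag.
apply: (reduce 1 (sym_second_exchange x y z u v Af Af' Ac Ad Ae Ag)).
apply: (reduce (f * f') (sym_second_permute x y z u v Ac Ad Ae Ag)).
by apply: ring0; ring.
Qed.

(** For each of the labels c, e, d, g let h_c, h_e, h_d, h_g be the product in
    which that label carries the second derivative and the others a first
    derivative, times f f', with the sign of the ordering of the labels.  By
    [abelian_skew], [sym_second_relabel] says that 2 h_i = h_j + h_k for all
    distinct labels i, j, k.  So the four products agree, and the expression
    below, which is h_c - h_e, vanishes; no division by 2 is involved. *)
Let sym_second_vanish f f' c d e g x y z u v :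
  A f -> A f' -> A c -> A d -> A e -> A g ->
  I (f * f' * (sym_second c e y x z * (d # u) * (g # v))).
Proof.
move=> Af Af' Ac Ad Ae Ag.
apply: (reduce (-1) (sym_second_relabel x y z u v Af Af' Ad Ac Ae Ag)).
apply: (reduce (-1) (sym_second_relabel x y z u v Af Af' Ad Ae Ac Ag)).
apply: (reduce (f * f' * (c # y # x) * (g # v)) (skew z u Ae Ad)).
apply: (reduce (f * f' * (e # y # x) * (g # v)) (skew z u Ac Ad)).
apply: (reduce (f * f' * (d # y # x) * (g # v)) (skew z u Ae Ac)).
apply: (reduce (- (f * f' * (d # y # x) * (g # z))) (skew u v Ac Ae)).
apply: (reduce (- (f * f' * (g # y # x) * (d # z))) (skew u v Ac Ae)).
by apply: ring0; rewrite /sym_second; ring.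
Qed.

(** Of the five multipliers, two are the coefficients f, f', and three are the
    first derivatives next to {{c,l},z} in [sym_second_transfer] and in
    [sym_second_vanish]. *)
Lemma derived_bracket_near_central c l z : A c -> L l ->
  colon_pow [set a # x | a in A & x in setT] 5 I (c # l # z).
Proof.
move=> Ac Ll _ [d Ad [x _ <-]] _ [e Ae [y _ <-]] _ [g Ag [v _ <-]].
move=> _ [f Af [s _ <-]] _ [f' Af' [s' _ <-]].
have h1 := sym_second_transfer x y z (Ax s Af) Ac Ad Ae Ll.
have h2 := sym_second_vanish x y z l v (Ax s Af) (Ax s' Af') Ac Ad Ae Ag.
apply: (reduce ((f' # s') * (g # v)) h1).
apply: (reduce (-1) h2).
by apply: ring0; ring.
Qed.
End Metabelian.

(** * Lie ideals whose bracket with their derived ideal is central *)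

Section CentralDerived.
Variables (F : fieldType) (P : poissonAlgType F) (I : set P).
Hypothesis iI : is_poisson_ideal I.
Variable L : set P.
Hypothesis iL : lie_ideal L.
Let A := bracket_span L L.
Hypothesis abA : forall a b, A a -> A b -> I (a # b).
Hypothesis cAL : forall c l z, A c -> L l -> I (c # l # z).
Implicit Types (a b c d e f g l m n k x y z t u v w q : P).

Let sI : is_subspace I := ideal_subspace iI.
Let iA : lie_ideal A := bracket_span_lie_ideal iL iL.
Let Ax a x : A a -> A (a # x) := @proj2 _ _ iA a x.
Let Lx l x : L l -> L (l # x) := @proj2 _ _ iL l x.
Let skew := abelian_skew iI iA abA.

Local Notation reduce p h := (ideal_reduce (p := p) iI h).
Local Notation ring0 := (ideal_eq0 iI).

(** Bracketing {c,{lx,y}} with m, n and q leaves only four terms, since {A,L}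
    is central; two of them cancel, and [abelian_skew] moves q to c in the
    other two. *)
Lemma derived_triple_skew c' l' c q l m n x y :
  A c' -> L l' -> A c -> L l -> L m -> L n ->
  I ((c' # l') * (c # q) * (x # m # n # (l # y) + l # y # n # (x # m))).
Proof.
move=> Ac' Ll' Ac Ll Lm Ln.
have: forall w, I (c' # l' # w) by move=> w; apply: cAL.
move: (c' # l') (Ax l' Ac') => s As sC.
have mulC u w : I (s * u) -> I (s * (u # w)).
  move=> h; apply: (reduce 1 (ideal_bracketl w iI h)).
  by apply: (reduce (- u) (sC w)); apply: ring0; rewrite bracketMl; ring.
(* The element s is central modulo I, so that s{u,v} is congruent to an
   element of L: in the presence of s, all brackets behave as elements of L. *)
have Luv u v : L ((u * s) # v) by apply: lie_ideal_absorb.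
have suv u v : I (s * (u # v) - (u * s) # v).
  by apply: (reduce (- u) (sC v)); apply: ring0; rewrite bracketMl; ring.
have cuv u v w : I (s * (c # (u # v) # w)).
  have h : I (c # (s * (u # v)) # w).
    apply: (reduce 1 (ideal_bracketl w iI (ideal_bracketr c iI (suv u v)))).
    apply: (reduce 1 (cAL w Ac (Luv u v))); apply: ring0.
    by rewrite (bracketDr _ _ c) bracketNr bracketDl bracketNl; ring.
  apply: (reduce 1 h); apply: (reduce (- (c # (u # v))) (sC w)).
  have uvcs := poisson_idealMl (u # v) iI (abA Ac As).
  apply: (reduce (-1) (ideal_bracketl w iI uvcs)).
  by apply: ring0; rewrite bracketMr bracketDl (bracketMl s); ring.
have xymn w : I (s * (x # y # m # n # w)).
  have h : I ((s * (x # y)) # m # n # w).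
    have sxymn := ideal_bracketl n iI (ideal_bracketl m iI (suv x y)).
    apply: (reduce 1 (ideal_bracketl w iI sxymn)).
    apply: (reduce 1 (cAL w (bracket_spanI (Luv x y) Lm) Ln)); apply: ring0.
    by rewrite !(bracketDl, bracketNl); ring.
  have h1 : I ((s * (x # y # m) - (s * (x # y)) # m) # n # w).
    do 2!apply: (ideal_bracketl _ iI).
    by apply: (reduce (- (x # y)) (sC m)); apply: ring0; rewrite bracketMl; ring.
  have h2 : I ((s * (x # y # m # n) - (s * (x # y # m)) # n) # w).
    apply: (ideal_bracketl _ iI).
    by apply: (reduce (- (x # y # m)) (sC n)); apply: ring0; rewrite bracketMl; ring.
  apply: (reduce 1 h); apply: (reduce 1 h1); apply: (reduce 1 h2).
  apply: (reduce (- (x # y # m # n)) (sC w)); apply: ring0.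
  by rewrite !(bracketDl, bracketNl) (bracketMl s (x # y # m # n)); ring.
have lC d k w : A d -> L k -> I (s * (d # k # w)).
  by move=> Ad Lk; apply: poisson_idealMl => //; apply: cAL.
have Lly : L (l # y) by apply: Lx.
(* The cross terms of cuv at the product of l and x; here and below the terms
   with a bracket of an element of {A,L} have been dropped. *)
have e1 : I (s * ((l # m) * (c # (x # y)) + (c # l) * (x # y # m)
    + (x # m) * (c # (l # y)) + (c # x # m) * (l # y) + (c # x) * (l # y # m))).
  apply: (reduce 1 (cuv (l * x) y m)); apply: (reduce (- l) (cuv x y m)).
  apply: (reduce (- (x # y)) (lC c l m Ac Ll)).
  apply: (reduce (- x) (lC c (l # y) m Ac Lly)).
  by apply: ring0; rewrite (bracketMl l x) !bracketE; ring.
have e2 : I (s * ((l # m # n) * (c # (x # y)) + (c # l) * (x # y # m # n)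
    + (x # m # n) * (c # (l # y)) + (c # x # m) * (l # y # n)
    + (c # x # n) * (l # y # m) + (c # x) * (l # y # m # n))).
  apply: (reduce 1 (mulC _ n e1)); apply: (reduce (- (l # m)) (cuv x y n)).
  apply: (reduce (- (x # y # m)) (lC c l n Ac Ll)).
  apply: (reduce (- (x # m)) (lC c (l # y) n Ac Lly)).
  apply: (reduce (- (l # y)) (lC _ _ n (Ax x Ac) Lm)).
  by apply: ring0; rewrite !(bracketDl, bracketMl _ _ n); ring.
have Aly k : L k -> A (l # y # k) by move=> Lk; apply: bracket_spanI.
have e3 : I (s * ((x # m # n # q) * (c # (l # y))
    + (c # x # m) * (l # y # n # q) + (c # x # n) * (l # y # m # q)
    + (c # x # q) * (l # y # m # n))).
  apply: (reduce 1 (mulC _ q e2)); apply: (reduce (- (l # m # n)) (cuv x y q)).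
  apply: (reduce (- (c # (x # y))) (lC _ _ q (bracket_spanI Ll Lm) Ln)).
  apply: (reduce (- (x # y # m # n)) (lC _ _ q Ac Ll)).
  apply: (reduce (- (c # l)) (xymn q)).
  apply: (reduce (- (x # m # n)) (lC _ _ q Ac Lly)).
  apply: (reduce (- (l # y # n)) (lC _ _ q (Ax x Ac) Lm)).
  apply: (reduce (- (l # y # m)) (lC _ _ q (Ax x Ac) Ln)).
  apply: (reduce (- (c # x)) (lC _ _ q (Aly m Lm) Ln)).
  by apply: ring0; rewrite !(bracketDl, bracketMl _ _ q); ring.
have Axmn : A (x # m # n) by apply: bracket_spanI => //; apply: lie_idealr.
apply: (reduce (-1) e3).
apply: (reduce s (skew n q (Ax x Ac) (Aly m Lm))).
apply: (reduce s (skew q (l # y) Ac Axmn)).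
apply: (reduce s (skew q (x # m) Ac (Aly n Ln))).
apply: (reduce (l # y # n # q) (lC _ _ x Ac Lm)).
by apply: ring0; rewrite (bracketA c x m); ring.
Qed.

Let L1 := bracket_span L setT.
Let A1 := bracket_span L1 L1.
Let subL1L : L1 `<=` L := bracket_span_subl iL.
Let subA1A : A1 `<=` A := bracket_spanS subL1L subL1L.

Section Multiplier.
Variables c' l' c q : P.
Hypotheses (Ac' : A c') (Ll' : L l') (Ac : A c).
Let s := (c' # l') * (c # q).

Let triple_alt p n r : L1 p -> L n -> L1 r ->
  I (s * (p # n # r + r # n # p)).
Proof.
move=> L1p Ln L1r.
have lin u : is_subspace [set p | I (s * (p # n # u + u # n # p))].
  apply: (@subspace_preim _ _ (fun p => s * (p # n # u + u # n # p)) I sI).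
  move=> a x y; rewrite !bracket_linearl bracket_linearr.
  rewrite (scalE a (x # n # u)) (scalE a (u # n # x)) (scalE a (s * _)).
  by ring.
suff h : L1 `<=` [set p | I (s * (p # n # r + r # n # p))] by apply: h.
apply: bracket_span_min => [|m x Lm _] /=; first exact: lin.
rewrite addrC.
suff h : L1 `<=` [set r | I (s * (r # n # (m # x) + m # x # n # r))].
  by apply: h.
apply: bracket_span_min => [|l y Ll _] /=; first exact: lin.
apply: (reduce (-1) (derived_triple_skew q x y Ac' Ll' Ac Ll Lm Ln)).
apply: ring0; rewrite /s (bracketC m x) !(bracketNl, bracketNr); ring.
Qed.

Let triple_rot p n r : L1 p -> L1 n -> L1 r ->
  I (s * (p # n # r - n # r # p)).
Proof.
move=> L1p L1n L1r; apply: (reduce 1 (triple_alt L1p (subL1L L1n) L1r)).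
by apply: ring0; rewrite (bracketC n r) bracketNl; ring.
Qed.

(** The triple brackets T(p,n,r) are alternating, so the Jacobi identity says
    that 3 T(p,n,r) = 0.  [abelian_skew] exchanges r and r' in T(p,n,r)
    T(p',n',r') with a sign, which makes this product alternating in all six
    arguments; exchanging the two triples is an odd permutation that fixes the
    product, so its double vanishes too. *)
Let triple_mul_vanish p n r p' n' r' :
  L1 p -> L1 n -> L1 r -> L1 p' -> L1 n' -> L1 r' ->
  I (s * (p # n # r * (p' # n' # r'))).
Proof.
move=> Lp Ln Lr Lp' Ln' Lr'.
have A_ x y : L1 x -> L1 y -> A (x # y).
  by move=> L1x L1y; apply: bracket_spanI; apply: subL1L.
have h3 : I (s * (p # n # r *+ 3)).
  apply: (reduce 1 (triple_rot Lp Ln Lr)).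
  apply: (reduce (-1) (triple_rot Lr Lp Ln)).
  apply: ring0; rewrite (bracketAC p n r) (bracketC p (n # r)) (bracketC r p).
  by rewrite bracketNl; ring.
have h2 : I (s * (p # n # r * (p' # n' # r') *+ 2)).
  apply: (reduce s (skew r r' (A_ p n Lp Ln) (A_ p' n' Lp' Ln'))).
  apply: (reduce (p' # n' # r) (triple_rot Lr' Lp Ln)).
  apply: (reduce (r' # p # n) (triple_rot Lr Lp' Ln')).
  apply: (reduce (- s) (skew n n' (A_ r' p Lr' Lp) (A_ r p' Lr Lp'))).
  apply: (reduce (- (r # p' # n)) (triple_rot Ln' Lr' Lp)).
  apply: (reduce (- (n' # r' # p)) (triple_rot Ln Lr Lp')).
  apply: (reduce s (skew p p' (A_ n' r' Ln' Lr') (A_ n r Ln Lr))).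
  apply: (reduce (n # r # p) (triple_rot Lp' Ln' Lr')).
  apply: (reduce (p' # n' # r') (triple_rot Lp Ln Lr)).
  by apply: ring0; ring.
apply: (reduce (p' # n' # r') h3); apply: (reduce (-1) h2).
by apply: ring0; ring.
Qed.

Lemma triple_pair_vanish a a' r r' : A1 a -> A1 a' -> L1 r -> L1 r' ->
  I (s * (a # r * (a' # r'))).
Proof.
move=> A1a A1a' L1r L1r'.
suff h : A1 `<=` [set a | I (s * (a # r * (a' # r')))] by apply: h.
apply: bracket_span_min => [|p n Lp Ln] /=.
  apply: (@subspace_preim _ _ (fun a => s * (a # r * (a' # r'))) I sI).
  move=> b x y; rewrite bracket_linearl (scalE b (x # r)) (scalE b (s * _)).
  by ring.
suff h : A1 `<=` [set a' | I (s * (p # n # r * (a' # r')))] by apply: h.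
apply: bracket_span_min => [|p' n' Lp' Ln'] /=.
  apply: (@subspace_preim _ _ (fun a => s * (p # n # r * (a # r'))) I sI).
  move=> b x y; rewrite bracket_linearl (scalE b (x # r')) (scalE b (s * _)).
  by ring.
exact: triple_mul_vanish.
Qed.
End Multiplier.

Lemma triple_pow : pow_sub (bracket_span A1 L1) 4 I.
Proof.
apply: colon_pow_span => // _ [a1 Aa1 [r1 Lr1 <-]] _ [a2 Aa2 [r2 Lr2 <-]].
move=> _ [a3 Aa3 [r3 Lr3 <-]] _ [a4 Aa4 [r4 Lr4 <-]].
rewrite mul1r -mulrA; apply: triple_pair_vanish => //; try exact: subA1A.
exact: subL1L.
Qed.
End CentralDerived.

(** * Nilpotency along the derived series *)

Section Nilpotency.
Variables (F : fieldType) (P : poissonAlgType F).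
Implicit Types (I L U V : set P).

Definition brackets U : set P := [set u # x | u in U & x in setT].

Lemma brackets_stable U : lie_ideal U -> bracket_stable (brackets U).
Proof.
by move=> iU _ y [u Uu [x _ <-]]; exists (u # x); [exact: iU.2 | exists y].
Qed.

Lemma derived_cube U V I : is_poisson_ideal I -> lie_ideal U -> lie_ideal V ->
  (forall a b, V a -> V b -> I (a # b)) ->
  (forall t x a, U t -> V a -> I (t # x # a)) ->
  bracket_span U U `<=` V ->
  pow_sub (brackets (bracket_span U U)) 3 I.
Proof.
move=> iI iU iV abV UV subV _ [w Uw [y _ <-]] _ [b /subV Vb [p _ <-]].
move=> _ [a /subV Va [x _ <-]]; rewrite mul1r.
suff h : bracket_span U U `<=` [set w | I (w * (b # p) * (a # x))].
  by apply: h; apply: (bracket_span_lie_ideal iU iU).2.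
apply: bracket_span_min => [|t t' Ut Ut'] /=.
  apply: (@subspace_preim _ _ (fun w => w * (b # p) * (a # x)) I).
    exact: ideal_subspace.
  by move=> c u v; rewrite (scalE c u) (scalE c (_ * _)); ring.
have -> : t # t' * (b # p) * (a # x) = t # t' * (p # b) * (x # a).
  by rewrite (bracketC b p) (bracketC a x); ring.
by apply: (second_centralizer_bracket iI iV abV) => // z c; apply: UV.
Qed.

Lemma central_mul_brackets U L I z z' g : is_poisson_ideal I -> lie_ideal U ->
  L `<=` bracket_span setT setT ->
  (forall v x, bracket_span U U v -> I (v # x)) ->
  bracket_span U U z -> bracket_span U U z' ->
  brackets (bracket_span L L) g -> I (z * z' * g).
Proof.
move=> iI iU LP cU Uz Uz' [a La [x _ <-]].
suff h : bracket_span L L `<=` [set a | I (z * z' * (a # x))] by apply: h.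
apply: bracket_span_min => [|y l /LP Ly /LP Ll] /=.
  apply: (@subspace_preim _ _ (fun a => z * z' * (a # x)) I).
    exact: ideal_subspace.
  move=> c u v; rewrite bracket_linearl (scalE c (u # x)) (scalE c (_ * _)).
  by ring.
exact: (central_mul_derived iI x iU cU Uz Uz' Ly Ll).
Qed.

(** With A = {L,L}, L1 = {L,P} and A1 = {L1,L1}, the exponent is
    89 = (4 * 3) * (2 * 3 + 1) + 5: the summand 5 makes {A,L} central; the
    factor 4 kills {A1,L1}, then the factor 3 kills {A1,P}, which makes A1
    central; the last factor is that of [pow_sub_square], once {A,P}^3 is
    known to vanish modulo A1. *)
Lemma pow_sub_metabelian L I : is_poisson_ideal I -> lie_ideal L ->
  L `<=` bracket_span setT setT ->
  (forall a b, bracket_span L L a -> bracket_span L L b -> I (a # b)) ->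
  pow_sub (brackets (bracket_span L L)) 89 I.
Proof.
move=> iI iL LP; set A := bracket_span L L => abA.
have iA : lie_ideal A := bracket_span_lie_ideal iL iL.
pose G := brackets A; have sG : bracket_stable G := brackets_stable iA.
pose I1 := colon_pow G 5 I.
have iI1 : is_poisson_ideal I1 by apply: colon_pow_ideal.
have II1 : I `<=` I1 by apply: sub_colon_pow.
have abA1 a b : A a -> A b -> I1 (a # b).
  by move=> Aa Ab; apply: II1; apply: abA.
have cAL c l z : A c -> L l -> I1 (c # l # z).
  exact: derived_bracket_near_central.
pose L1 := bracket_span L setT; pose A1 := bracket_span L1 L1.
have iL1 : lie_ideal L1 := bracket_span_lie_ideal iL (lie_ideal_setT P).
have iA1 : lie_ideal A1 := bracket_span_lie_ideal iL1 iL1.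
have L1L : L1 `<=` L by apply: bracket_span_subl.
have A1A : A1 `<=` A by apply: bracket_spanS.
pose W := bracket_span A1 L1.
have iW : lie_ideal W := bracket_span_lie_ideal iA1 iL1.
pose I2 := ideal_add I1 W.
have I2pow : pow_sub I2 4 I1.
  by apply: pow_sub_ideal_add => //; [exact: iW.2 | exact: triple_pow].
have R3 : pow_sub (brackets A1) 3 I2.
  apply: (derived_cube (U := L1) (V := A1) (I := I2)) => //.
  - exact: ideal_add_ideal.
  - by move=> a b Aa Ab; apply: sub_ideal_addl; apply: abA1; apply: A1A.
  - move=> t x a L1t A1a; rewrite bracketC.
    apply: (subspaceN (ideal_subspace (ideal_add_ideal _ _))).
    by apply: sub_ideal_addr; apply: bracket_spanI => //; apply: iL1.2.
pose I3 := ideal_add I1 (brackets A1).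
have iI3 : is_poisson_ideal I3 by apply: ideal_add_ideal.
have I3pow : pow_sub I3 (4 * 3) I1.
  apply: pow_sub_ideal_add => //; first exact: brackets_stable.
  exact: (pow_sub_trans R3 I2pow).
have G3 : pow_sub G 3 (ideal_add I3 A1).
  apply: (derived_cube (U := L) (V := L1) (I := ideal_add I3 A1)) => //.
  - exact: ideal_add_ideal.
  - by move=> a b L1a L1b; apply: sub_ideal_addr; apply: bracket_spanI.
  - move=> t x a Lt L1a; apply: sub_ideal_addr.
    by apply: bracket_spanI => //; apply: bracket_spanI.
  - by apply: bracket_spanS.
have G7 : pow_sub G (2 * 3).+1 I3.
  apply: (pow_sub_square iI3 iA1.2 sG G3).
  move=> w w' g Ww Ww'; apply: (central_mul_brackets iI3 iL1) => // v x A1v.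
  by apply: sub_ideal_addr; exists v => //; exists x.
rewrite /pow_sub (_ : 89 = (4 * 3) * (2 * 3).+1 + 5)%N // colon_powD.
exact: (pow_sub_trans G7 I3pow).
Qed.

Lemma pow_sub_central L I : is_poisson_ideal I -> lie_ideal L ->
  L `<=` bracket_span setT setT ->
  (forall v x, bracket_span (bracket_span L L) (bracket_span L L) v ->
     I (v # x)) ->
  pow_sub (brackets (bracket_span L L)) 179 I.
Proof.
move=> iI iL LP cA.
have iA := bracket_span_lie_ideal iL iL.
have iAA := bracket_span_lie_ideal iA iA.
apply: (pow_sub_square (k := 89) iI iAA.2 (brackets_stable iA)).
  apply: pow_sub_metabelian => //; first exact: ideal_add_ideal.
  by move=> a b Aa Ab; apply: sub_ideal_addr; apply: bracket_spanI.
by move=> w w' g Ww Ww'; apply: (central_mul_brackets iI iA).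
Qed.

Lemma delta_lie_ideal k : lie_ideal (@delta F P k).
Proof.
elim: k => [|k IH]; first exact: lie_ideal_setT.
exact: bracket_span_lie_ideal.
Qed.

Lemma pow_sub_delta j k : @delta F P (k.+2 + j) = [set 0] ->
  pow_sub (brackets (@delta F P k.+2)) (179 ^ j) [set 0].
Proof.
elim: j k => [|j IH] k dk.
  move=> _ [u + [x _ <-]]; rewrite -[k.+2]addn0 dk => ->.
  by rewrite bracket0l mulr0.
have IH' : pow_sub (brackets (@delta F P k.+3)) (179 ^ j) [set 0].
  by apply: IH; rewrite addSnnS.
have sG := brackets_stable (delta_lie_ideal k.+3).
rewrite expnSr; apply: pow_sub_trans (colon_pow_gen sG (@zero_ideal F P) IH').
apply: (pow_sub_central (L := @delta F P k.+1)).
- exact: poisson_ideal_gen_ideal.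
- exact: delta_lie_ideal.
- exact: bracket_spanS.
- by move=> v x dv; apply: sub_poisson_ideal_gen; exists v => //; exists x.
Qed.

Lemma pow_sub_assoc_nilpotent (J : set P) k :
  pow_sub J k [set 0] -> assoc_nilpotent J k.
Proof.
move=> h x Jx; rewrite -[LHS]mul1r.
suff prod0 y : colon_pow J k [set 0] y -> y * \prod_(i < k) x i = 0.
  exact: prod0.
elim: k y x Jx {h} => [|k IH] y x Jx h; first by rewrite big_ord0 mulr1.
by rewrite big_ord_recl mulrA; apply: IH => [i|]; [exact: Jx | apply: h].
Qed.

Lemma delta_eq0_addr n m :
  @delta F P n = [set 0] -> @delta F P (m + n) = [set 0].
Proof.
move=> dn; elim: m => [//|m IH]; rewrite addSn /= IH.
apply/seteqP; split=> [|x ->]; last exact: (bracket_span_subspace _ _).1.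
apply: bracket_span_min => [|x y -> ->] /=; last exact: bracket0l.
exact: ideal_subspace (zero_ideal P).
Qed.
End Nilpotency.

Theorem theorem3p3 :
  exists f : nat -> nat,
    forall (F : fieldType) (P : poissonAlgType F) (n : nat),
      has_derived_length P n ->
      assoc_nilpotent (poisson_ideal_gen (center_by_metabelian_values P)) (f n).
Proof.
exists (fun n => (179 ^ n)%N) => F P n [/(delta_eq0_addr 2) dn _].
apply: pow_sub_assoc_nilpotent.
have h := colon_pow_gen (brackets_stable (delta_lie_ideal P 2)) (zero_ideal P)
  (pow_sub_delta dn).
apply: colon_pow_anti h; apply: poisson_ideal_gen_min.
  exact: poisson_ideal_gen_ideal.
move=> _ [x1 [x2 [x3 [x4 [x5 ->]]]]]; apply: sub_poisson_ideal_gen.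
exists (x1 # x2 # (x3 # x4)); last by exists x5.
by apply: bracket_spanI; apply: bracket_spanI.
Qed.
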